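(* Let $K$ be an algebraically closed field of characteristic $p>0$ and let $n$ be a positive integer. Then $K[\mathrm{SL}_n]^{\mathfrak{sl}_n}$ has a rational field of fractions, that is, its field of fractions is a purely transcendental extension of $K$.
   Context: $\mathrm{SL}_n$ is the special linear group over $K$ and $\mathfrak{sl}_n$ is its Lie algebra. The conjugation action of $\mathrm{SL}_n$ on itself induces an action of $\mathrm{SL}_n$ on the algebra $K[\mathrm{SL}_n]$ of regular functions by algebra automorphisms; differentiating gives the conjugation action of $\mathfrak{sl}_n$ on $K[\mathrm{SL}_n]$ by derivations (explicitly, $x$ acts by the left invariant vector field determined by $x$ minus the right invariant vector field determined by $x$). $K[\mathrm{SL}_n]^{\mathfrak{sl}_n}=\{f : x\cdot f=0\text{ for all }x\in\mathfrak{sl}_n\}$. No assumption is made on $p$ in relation to $n$. *)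

(* Defs.v *)
(* MathComp, with multinomials; mathcomp.classical is used only to turn
   propositions (ideal membership, invertibility, invariance) into booleans. *)
From HB Require Import structures.
From mathcomp Require Import all_boot all_order all_fingroup all_algebra.
From mathcomp Require Import generic_quotient ring_quotient fraction ring.
From mathcomp Require Import boolp.
From mathcomp Require Import mpoly.

Set Implicit Arguments.
Unset Strict Implicit.
Unset Printing Implicit Defensive.

Import GRing.Theory.
Local Open Scope ring_scope.
Local Open Scope quotient_scope.

(* The coordinate ring K[Mat_n] of n x n matrices: the variable of index
   [mxvec_index i j] is the (i, j) coordinate function. *)
Notation matpoly K n := {mpoly K[n * n]}.

Fact det_dim0 (R : comNzRingType) n (A : 'M[R]_n) : n = 0%N -> \det A = 1.
Proof. by move=> n0; move: A; rewrite n0 => A; rewrite det_mx00. Qed.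

Section CoordinateRing.
Variables (K : fieldType) (n : nat).
Implicit Types (P Q : matpoly K n) (x : 'M[K]_n).

Definition genmx : 'M[matpoly K n]_n := \matrix_(i, j) 'X_(mxvec_index i j).

Definition in_sl_ideal P := exists Q, P = Q * (\det genmx - 1).

Definition sl_ideal : {pred matpoly K n} := fun P => `[< in_sl_ideal P >].

Lemma sl_idealP P : reflect (in_sl_ideal P) (P \in sl_ideal).
Proof. exact: asboolP. Qed.

Lemma in_sl_ideal0 : in_sl_ideal 0.
Proof. by exists 0; rewrite mul0r. Qed.

Lemma in_sl_idealD P Q : in_sl_ideal P -> in_sl_ideal Q -> in_sl_ideal (P + Q).
Proof. by move=> [A ->] [B ->]; exists (A + B); rewrite mulrDl. Qed.

Lemma in_sl_idealM P Q : in_sl_ideal Q -> in_sl_ideal (P * Q).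
Proof. by move=> [A ->]; exists (P * A); rewrite mulrA. Qed.

Lemma meval_det (M : 'M[K]_n) :
  (\det genmx).@[fun k => mxvec M 0 k] = \det M.
Proof.
rewrite -det_map_mx; congr (\det _); apply/matrixP => i j.
by rewrite !mxE /= mevalXU mxvecE.
Qed.

Lemma det_genmx_neq0 : \det genmx != 0.
Proof.
apply/eqP => d0; have := meval_det 1%:M.
by rewrite d0 meval0 det1 => /eqP; rewrite eq_sym oner_eq0.
Qed.

Lemma in_sl_ideal1 : ~ in_sl_ideal 1.
Proof.
move=> [Q /(congr1 (meval (fun k => mxvec (1%:M : 'M[K]_n) 0 k)))].
rewrite mevalM mevalB meval_det !meval1 det1 subrr mulr0.
by move/eqP; rewrite oner_eq0.
Qed.

Lemma sl_ideal_closed : idealr_closed sl_ideal.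
Proof.
split; first exact/sl_idealP/in_sl_ideal0.
  by apply/sl_idealP/in_sl_ideal1.
move=> A P Q /sl_idealP hP /sl_idealP hQ; apply/sl_idealP.
by apply: in_sl_idealD => //; apply: in_sl_idealM.
Qed.

HB.instance Definition _ := isIdealr.Build (matpoly K n) sl_ideal sl_ideal_closed.

(* Primality of (det - 1): it is the kernel of the morphism to K(Mat_n) that
   divides the first row of the generic matrix by its determinant. *)
Let F := {fraction matpoly K n}.
Let d : F := FracField.tofrac (\det genmx).
Let rowc (i : 'I_n) : F := if val i == 0%N then d^-1 else 1.
Let normmx : 'M[F]_n := \matrix_(i, j) (rowc i * FracField.tofrac (genmx i j)).
Let phi : matpoly K n -> F :=
  mmap (@FracField.tofrac (matpoly K n) \o @mpolyC (n * n) K)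
       (fun k => mxvec normmx 0 k).

Let d_neq0 : d != 0.
Proof. by rewrite tofrac_eq0 det_genmx_neq0. Qed.

Let det_normmx : \det normmx = 1.
Proof.
have -> : normmx = diag_mx (\row_i rowc i)
                     *m map_mx (@FracField.tofrac (matpoly K n)) genmx.
  by apply/matrixP => i j; rewrite mul_diag_mx !mxE.
rewrite det_mulmx det_diag (det_map_mx (@FracField.tofrac (matpoly K n))).
rewrite -/d; under eq_bigr do rewrite mxE.
have [n0|n_gt0] := posnP n.
  rewrite /d det_dim0 // rmorph1 mulr1 big1 // => i _.
  by case: i => i lt_in; exfalso; rewrite n0 in lt_in.
rewrite (bigD1 (Ordinal n_gt0)) //= big1 ?mulr1 => [|i].
  by rewrite /rowc eqxx mulVf.
by rewrite /rowc -val_eqE /= => /negPf ->.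
Qed.

Let localized P := exists N Q,
  d ^+ N * phi P = FracField.tofrac Q /\ in_sl_ideal (Q - (\det genmx) ^+ N * P).

Let localizedC c : localized c%:MP.
Proof.
exists 0%N, c%:MP; rewrite !expr0 !mul1r subrr /phi mmapC.
by split=> //; exact: in_sl_ideal0.
Qed.

Let localizedX k : localized 'X_k.
Proof.
case/mxvec_indexP: k => i j; rewrite /localized /phi mmapX mmap1U mxvecE mxE.
rewrite mxE /rowc; case: ifP => _.
  exists 1%N, 'X_(mxvec_index i j); rewrite !expr1 mulrA divff ?mul1r //.
  by split=> //; exists (- 'X_(mxvec_index i j)); ring.
exists 0%N, 'X_(mxvec_index i j); rewrite !expr0 !mul1r subrr.
by split=> //; exact: in_sl_ideal0.
Qed.

Let localizedD P Q : localized P -> localized Q -> localized (P + Q).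
Proof.
move=> [N [A [hA iA]]] [M [B [hB iB]]].
exists (N + M)%N, ((\det genmx) ^+ M * A + (\det genmx) ^+ N * B); split.
  rewrite /phi !rmorphD !rmorphM !rmorphXn /= -hA -hB exprD -/d /phi; ring.
rewrite exprD [X in in_sl_ideal X](_ : _ =
  (\det genmx) ^+ M * (A - (\det genmx) ^+ N * P) +
  (\det genmx) ^+ N * (B - (\det genmx) ^+ M * Q)); last by ring.
by apply: in_sl_idealD; apply: in_sl_idealM.
Qed.

Let localizedM P Q : localized P -> localized Q -> localized (P * Q).
Proof.
move=> [N [A [hA iA]]] [M [B [hB iB]]]; exists (N + M)%N, (A * B); split.
  rewrite /phi !rmorphM /= -hA -hB exprD /phi; ring.
rewrite exprD [X in in_sl_ideal X](_ : _ =
  B * (A - (\det genmx) ^+ N * P) +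
  (\det genmx) ^+ N * P * (B - (\det genmx) ^+ M * Q)); last by ring.
by apply: in_sl_idealD; apply: in_sl_idealM.
Qed.

Let localizedP P : localized P.
Proof.
elim/mpolyind: P => [|c m P _ _ IH]; first by rewrite -mpolyC0; apply: localizedC.
apply: localizedD => //; rewrite -mul_mpolyC; apply: localizedM.
  exact: localizedC.
rewrite mpolyXE_id; elim/big_ind: _ => [|A B|i _].
- by rewrite -mpolyC1; apply: localizedC.
- exact: localizedM.
elim: (m i) => [|e IHe]; first by rewrite expr0 -mpolyC1; apply: localizedC.
by rewrite exprS; apply: localizedM.
Qed.

Let phi_det : phi (\det genmx) = 1.
Proof.
rewrite /phi -det_map_mx -[RHS]det_normmx; congr (\det _).
by apply/matrixP => i j; rewrite 2![in LHS]mxE /= mmapX mmap1U mxvecE.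
Qed.

Let sl_ideal_phi P : (P \in sl_ideal) = (phi P == 0).
Proof.
apply/sl_idealP/eqP => [[Q ->]|P0].
  by rewrite /phi rmorphM rmorphB rmorph1 /= -/phi phi_det subrr mulr0.
have [N [Q []]] := localizedP P.
rewrite P0 mulr0 => /esym/eqP; rewrite tofrac_eq0 => /eqP ->.
rewrite sub0r -mulNr => iP.
rewrite [P](_ : _ = (1 - (\det genmx) ^+ N) * P +
   (-1) * (- (\det genmx) ^+ N * P)); last by ring.
apply: in_sl_idealD; last exact: in_sl_idealM.
rewrite mulrC; apply: in_sl_idealM.
rewrite -(expr1n _ N) subrXX -opprB; set S := \sum_(_ < _) _.
by exists (- S); ring.
Qed.

Lemma sl_ideal_prime : prime_idealr_closed sl_ideal.
Proof.
by move=> P Q; rewrite !sl_ideal_phi /phi rmorphM mulf_eq0.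
Qed.

HB.instance Definition _ :=
  isPrimeIdealrClosed.Build (matpoly K n) sl_ideal sl_ideal_prime.

End CoordinateRing.

(* K[SL_n] = K[Mat_n] / (det - 1). *)
Definition coord_sl (K : fieldType) (n : nat) := {ideal_quot (@sl_ideal K n)}.

HB.instance Definition _ (K : fieldType) n := GRing.ComNzRing.on (coord_sl K n).

Section CoordinateRingSL.
Variables (K : fieldType) (n : nat).
Local Notation A := (coord_sl K n).
Implicit Types (P Q : matpoly K n) (x y : 'M[K]_n) (f g : A).

(* Restriction of polynomial functions from Mat_n to SL_n. *)
Definition restr P : A := \pi_({ideal_quot (@sl_ideal K n)}) P.

Fact restr_is_zmod_morphism : zmod_morphism restr.
Proof. by move=> P Q; rewrite /restr rmorphB. Qed.

Fact restr_is_monoid_morphism : monoid_morphism restr.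
Proof. by split=> [|P Q]; rewrite /restr (rmorph1, rmorphM). Qed.

HB.instance Definition _ :=
  GRing.isZmodMorphism.Build (matpoly K n) A restr restr_is_zmod_morphism.
HB.instance Definition _ :=
  GRing.isMonoidMorphism.Build (matpoly K n) A restr restr_is_monoid_morphism.

Definition lift_sl f : matpoly K n := repr (f : {ideal_quot (@sl_ideal K n)}).

Lemma lift_slK : cancel lift_sl restr.
Proof. by move=> f; rewrite /restr /lift_sl reprK. Qed.

Lemma restr_eq0 P : restr P = 0 <-> in_sl_ideal P.
Proof.
rewrite /restr -[0](rmorph0 (\pi_({ideal_quot (@sl_ideal K n)}))).
split=> [/eqP|/sl_idealP iP]; last by apply/eqP; rewrite -Quotient.idealrBE subr0.
by rewrite -Quotient.idealrBE subr0 => /sl_idealP.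
Qed.

Definition unit_sl : {pred A} := fun f => `[< exists g, g * f = 1 >].

Definition inv_sl f : A :=
  if pselect (exists g, g * f = 1) is left ex_g then projT1 (cid ex_g) else f.

Fact mulVsl : {in unit_sl, left_inverse 1 inv_sl *%R}.
Proof.
move=> f /asboolP uf; rewrite /inv_sl; case: pselect => // ex_g.
exact: (projT2 (cid ex_g)).
Qed.

Fact unit_slP f g : g * f = 1 -> unit_sl f.
Proof. by move=> gf1; apply/asboolP; exists g. Qed.

Fact inv_sl_out : {in [predC unit_sl], inv_sl =1 id}.
Proof.
by move=> f /asboolP nuf; rewrite /inv_sl; case: pselect.
Qed.

HB.instance Definition _ :=
  GRing.ComNzRing_hasMulInverse.Build A mulVsl unit_slP inv_sl_out.

Fact mulf_eq0_sl f g : f * g = 0 -> (f == 0) || (g == 0).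
Proof. exact: (@Quotient.rquot_IdomainAxiom _ (@sl_ideal K n)). Qed.

HB.instance Definition _ := GRing.ComUnitRing_isIntegral.Build A mulf_eq0_sl.

Definition cstmx x : 'M[matpoly K n]_n := map_mx (@mpolyC (n * n) K) x.

(* The derivation of K[Mat_n] given by the vector field with value V(g) at g,
   the entries of V being polynomial in g. *)
Definition vfield (V : 'M[matpoly K n]_n) P : matpoly K n :=
  \sum_i \sum_j V i j * P^`M(mxvec_index i j).

(* Tangent vectors d/dt g(1 + tx) = gx and d/dt (1 + tx)g = xg at t = 0. *)
Definition linv_field x := vfield (genmx K n *m cstmx x).
Definition rinv_field x := vfield (cstmx x *m genmx K n).

Definition conj_poly x P := linv_field x P - rinv_field x P.

(* The conjugation action: (x.f)(g) is the derivative at t = 0 of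
   f((1 - tx) g (1 + tx)).  [conj_actE] shows that the choice of the
   representative is irrelevant. *)
Definition conj_act x f : A := restr (conj_poly x (lift_sl f)).

Lemma vfieldB V P Q : vfield V (P - Q) = vfield V P - vfield V Q.
Proof.
rewrite /vfield -sumrB; apply: eq_bigr => i _; rewrite -sumrB.
by apply: eq_bigr => j _; rewrite mderivB mulrBr.
Qed.

Lemma vfieldM V P Q : vfield V (P * Q) = vfield V P * Q + P * vfield V Q.
Proof.
rewrite /vfield mulr_suml mulr_sumr -big_split; apply: eq_bigr => i _ /=.
rewrite mulr_suml mulr_sumr -big_split; apply: eq_bigr => j _ /=.
by rewrite mderivM; ring.
Qed.

Lemma vfieldC V c : vfield V c%:MP = 0.
Proof.
by rewrite /vfield big1 // => i _; rewrite big1 // => j _; rewrite mderivC mulr0.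
Qed.

Lemma conj_polyE x :
  conj_poly x =1 vfield (genmx K n *m cstmx x - cstmx x *m genmx K n).
Proof.
move=> P; rewrite /conj_poly /linv_field /rinv_field /vfield -sumrB.
apply: eq_bigr => i _; rewrite -sumrB; apply: eq_bigr => j _.
by rewrite -mulrBl; congr (_ * _); rewrite [RHS]mxE; congr (_ + _); rewrite [RHS]mxE.
Qed.

Fact mpolyC_sign m : ((-1) ^+ m)%:MP = (-1) ^+ m :> matpoly K n.
Proof. by rewrite rmorphXn rmorphN rmorph1. Qed.

Lemma mderiv_genmx i j i' j' :
  (genmx K n i' j')^`M(mxvec_index i j) = ((i' == i) && (j' == j))%:R.
Proof.
rewrite mxE mderivX mnm1E; case: (eqVneq (mxvec_index i' j') _) => [e|ne].
  have [-> ->] : i' = i /\ j' = j.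
    by have /enum_rank_inj[-> ->] := cast_ord_inj e.
  by rewrite !eqxx scale1r -mpolyX0; congr 'X_[_]; apply/mnmP=> k; rewrite mnmBE subnn mnm0E.
rewrite scale0r; case: andP => // -[/eqP ei /eqP ej].
by rewrite ei ej eqxx in ne.
Qed.

Lemma mderiv_prod0 k (I : finType) (G : I -> matpoly K n) :
  (forall a, (G a)^`M(k) = 0) -> (\prod_a G a)^`M(k) = 0.
Proof.
move=> G0; elim/big_ind: _ => [|P Q P0 Q0|a _]; first by rewrite -mpolyC1 mderivC.
  by rewrite mderivM P0 Q0 mul0r mulr0 addr0.
exact: G0.
Qed.

Lemma mderiv_cofactor i j j' : (cofactor (genmx K n) i j')^`M(mxvec_index i j) = 0.
Proof.
rewrite /cofactor /determinant.
rewrite mderivM -[(-1) ^+ _]mpolyC_sign mderivC mul0r add0r raddf_sum big1 ?mulr0 // => s _ /=.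
rewrite mderivM -[(-1) ^+ _]mpolyC_sign mderivC mul0r add0r mderiv_prod0 ?mulr0 // => a.
by rewrite 2!mxE -[X in X^`M(_)]/(genmx K n _ _) mderiv_genmx eq_sym (negPf (neq_lift _ _)).
Qed.

Lemma mderiv_det i j : (\det (genmx K n))^`M(mxvec_index i j)
   = cofactor (genmx K n) i j.
Proof.
rewrite (expand_det_row _ i) raddf_sum (bigD1 j) //= big1 ?addr0 => [|j' ne_j'].
  by rewrite mderivM mderiv_genmx mderiv_cofactor !eqxx mul1r mulr0 addr0.
by rewrite mderivM mderiv_genmx mderiv_cofactor (negPf ne_j') andbF mul0r mulr0 addr0.
Qed.

Lemma conj_poly_det x : conj_poly x (\det (genmx K n)) = 0.
Proof.
rewrite conj_polyE /vfield; set X := genmx K n; set x' := cstmx x.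
transitivity (\tr ((X *m x' - x' *m X) *m \adj X)).
  rewrite /mxtrace; apply: eq_bigr => i _; rewrite mxE; apply: eq_bigr => j _.
  by rewrite mderiv_det [\adj _ _ _]mxE.
rewrite mulmxBl raddfB /= -!mulmxA mul_mx_adj.
by rewrite mxtrace_mulC -mulmxA mul_adj_mx subrr.
Qed.

Lemma conj_act_wd x P : in_sl_ideal P -> in_sl_ideal (conj_poly x P).
Proof.
move=> [Q ->]; exists (conj_poly x Q); have := conj_poly_det x.
rewrite !conj_polyE vfieldM vfieldB => ->.
by rewrite -mpolyC1 vfieldC subrr mulr0 addr0.
Qed.

Lemma conj_actE x P : conj_act x (restr P) = restr (conj_poly x P).
Proof.
apply/eqP; rewrite -subr_eq0 /conj_act -rmorphB; apply/eqP/restr_eq0.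
rewrite !conj_polyE -vfieldB -conj_polyE; apply: conj_act_wd.
by apply/restr_eq0; rewrite [LHS]rmorphB [X in X - _]lift_slK subrr.
Qed.

Lemma conj_actB x f g : conj_act x (f - g) = conj_act x f - conj_act x g.
Proof.
rewrite -[f]lift_slK -[g]lift_slK -rmorphB !conj_actE -rmorphB.
by rewrite !conj_polyE vfieldB.
Qed.

Lemma conj_actM x f g : conj_act x (f * g) = conj_act x f * g + f * conj_act x g.
Proof.
rewrite -[f]lift_slK -[g]lift_slK -rmorphM !conj_actE -!rmorphM -rmorphD.
by rewrite !conj_polyE vfieldM.
Qed.

Lemma conj_actC x (c : K) : conj_act x (restr c%:MP) = 0.
Proof. by rewrite conj_actE conj_polyE vfieldC rmorph0. Qed.

Definition sl_lie : {pred 'M[K]_n} := fun x => \tr x == 0.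

Definition sl_invariant : {pred A} :=
  fun f => `[< forall x, x \in sl_lie -> conj_act x f = 0 >].

Fact sl_invariant_divring_closed : divring_closed sl_invariant.
Proof.
split.
- by apply/asboolP => x _; rewrite -(rmorph1 restr) -mpolyC1 conj_actC.
- move=> f g /asboolP hf /asboolP hg; apply/asboolP => x xsl.
  by rewrite conj_actB hf // hg // subrr.
move=> f g /asboolP hf /asboolP hg; apply/asboolP => x xsl.
rewrite conj_actM hf // mul0r add0r.
have [ug|/invr_out->] := boolP (g \is a GRing.unit); last by rewrite hg ?mulr0.
have: conj_act x (g^-1 * g) = 0.
  by rewrite mulVr // -(rmorph1 restr) -mpolyC1 conj_actC.
rewrite conj_actM hg // mulr0 addr0 => /eqP; rewrite mulf_eq0 => /orP[/eqP->|/eqP g0].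
  by rewrite mulr0.
by move: ug; rewrite g0 unitr0.
Qed.

HB.instance Definition _ :=
  GRing.isDivringClosed.Build A sl_invariant sl_invariant_divring_closed.

(* K[SL_n]^{sl_n}, as an integral domain. *)
Record sl_invariants := SLInvariant {
  sl_invariant_val :> A;
  _ : sl_invariant_val \in sl_invariant
}.

HB.instance Definition _ := [isSub for sl_invariant_val].
HB.instance Definition _ := [Choice of sl_invariants by <:].
HB.instance Definition _ :=
  [SubChoice_isSubIntegralDomain of sl_invariants by <:].

Fact sl_invariant_cst c : restr c%:MP \in sl_invariant.
Proof. by apply/asboolP => x _; rewrite conj_actC. Qed.

(* The embedding of K as the constant functions. *)
Definition sl_invariants_cst c := SLInvariant (sl_invariant_cst c).

Fact sl_invariants_cst_is_zmod_morphism : zmod_morphism sl_invariants_cst.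
Proof. by move=> a b; apply: val_inj; rewrite rmorphB /= mpolyCB rmorphB. Qed.

Fact sl_invariants_cst_is_monoid_morphism : monoid_morphism sl_invariants_cst.
Proof.
split=> [|a b]; apply: val_inj; rewrite ?rmorph1 ?rmorphM /=.
  by rewrite mpolyC1 rmorph1.
by rewrite mpolyCM rmorphM.
Qed.

HB.instance Definition _ := GRing.isZmodMorphism.Build K sl_invariants
  sl_invariants_cst sl_invariants_cst_is_zmod_morphism.
HB.instance Definition _ := GRing.isMonoidMorphism.Build K sl_invariants
  sl_invariants_cst sl_invariants_cst_is_monoid_morphism.

End CoordinateRingSL.

Section Rational.
Variables (K L : fieldType) (iota : {rmorphism K -> L}).

Definition alg_independent r (t : 'I_r -> L) :=
  forall P : {mpoly K[r]}, mmap iota t P = 0 -> P = 0.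

Definition field_generates r (t : 'I_r -> L) :=
  forall z : L, exists P Q : {mpoly K[r]},
    mmap iota t Q != 0 /\ z = mmap iota t P / mmap iota t Q.

(* L is K-isomorphic to a field K(x_1, ..., x_r) of rational functions: it is
   purely transcendental over K, with a finite transcendence basis t. *)
Definition rational_extension :=
  exists r (t : 'I_r -> L), alg_independent t /\ field_generates t.

End Rational.

(* Main.v *)
(* Let X be the generic matrix of SL_n and G = [e_1, X e_1, ..., X^(n-1) e_1].
   Cayley-Hamilton gives X G = G C, where C is the companion matrix of the
   characteristic polynomial of X.  Hence K(SL_n) is generated by the entries u
   of the last n - 1 columns of G and the non-constant coefficients s of the
   characteristic polynomial, and these are algebraically independent because
   they can be prescribed freely: G C G^-1 realizes any values.
   The s are invariant and so are the p-th powers u^p.  Conversely, an invariant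
   function is, up to a denominator that is a p-th power, a polynomial P(u, s).
   Its invariance says that the matrix W of the partial derivatives dP/du is
   orthogonal to the infinitesimal variation of G along sl_n.  Pairing W with
   this variation extends to a linear form on gl_n that vanishes on sl_n and at
   X; as tr X <> 0 it is zero, and this forces W = 0.  So P is a polynomial in
   u^p and s, and (u^p, s) is a transcendence basis generating the field of
   fractions of the invariants. *)
Require Import Defs.
From HB Require Import structures.
From mathcomp Require Import all_boot all_order all_fingroup all_algebra.
From mathcomp Require Import generic_quotient fraction ring.
From mathcomp Require Import boolp.
From mathcomp Require Import mpoly.

Set Implicit Arguments.
Unset Strict Implicit.
Unset Printing Implicit Defensive.

Import GRing.Theory.
Local Open Scope ring_scope.

(** * The Krylov matrix and its companion matrix *)

Section Krylov.
Variables (R : comNzRingType) (m : nat).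
Implicit Types (X G : 'M[R]_m.+1) (a : nat -> R).

Definition krylov X : 'M[R]_m.+1 := \matrix_(i, j) (X ^+ j) i 0.

(* Unlike [companionmx], sized by [m] and not by a polynomial. *)
Definition companion_mx a : 'M[R]_m.+1 :=
  \matrix_(i, j) if j == m :> nat then - a i else (i == j.+1 :> nat)%:R.

Lemma mul_companion_mx G a i j : (G *m companion_mx a) i j =
  if j == m :> nat then - \sum_(k < m.+1) a k * G i k else G i (inord j.+1).
Proof.
rewrite mxE; case: ifPn => jm.
  rewrite -sumrN; apply: eq_bigr => k _.
  by rewrite mxE jm mulrN mulrC.
have lt_jm : (j.+1 < m.+1)%N by rewrite ltnS ltn_neqAle jm -ltnS ltn_ord.
rewrite (bigD1 (inord j.+1)) //= big1 ?addr0 => [|k nk].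
  by rewrite mxE (negPf jm) inordK // eqxx mulr1.
rewrite mxE (negPf jm) -[j.+1](@inordK m) //.
by rewrite (_ : (_ == _ :> nat) = (k == inord j.+1)) // (negPf nk) mulr0.
Qed.

Lemma Cayley_Hamilton_expr X :
  X ^+ m.+1 = - \sum_(k < m.+1) (char_poly X)`_k *: X ^+ k.
Proof.
apply/eqP; rewrite -addr_eq0; apply/eqP.
rewrite -[RHS](Cayley_Hamilton X) -[char_poly X in RHS]coefK size_char_poly.
rewrite poly_def raddf_sum /= [RHS]big_ord_recr /= [LHS]addrC; congr (_ + _).
  by apply: eq_bigr => k _; rewrite horner_mxZ rmorphXn /= horner_mx_X.
rewrite horner_mxZ rmorphXn /= horner_mx_X.
have := monicP (char_poly_monic X); rewrite lead_coefE size_char_poly /= => ->.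
by rewrite scale1r.
Qed.

Lemma mul_krylov X i j : (X *m krylov X) i j = (X ^+ j.+1) i 0.
Proof.
by rewrite exprS !mxE; apply: eq_bigr => k _; rewrite !mxE.
Qed.

Lemma krylov_companion X :
  X *m krylov X = krylov X *m companion_mx (fun k => (char_poly X)`_k).
Proof.
apply/matrixP => i j; rewrite mul_krylov mul_companion_mx.
case: ifPn => [/eqP->|jm].
  rewrite Cayley_Hamilton_expr mxE summxE; congr (- _).
  by apply: eq_bigr => k _; rewrite !mxE.
by rewrite mxE inordK // ltnS ltn_neqAle jm -ltnS ltn_ord.
Qed.

(** Column by column: G starts with e_0, and each column of the equation before the last says that X
    sends a column of G to the next one. *)
Lemma krylov_unique X G a :
  (forall i, G i 0 = (i == 0)%:R) -> X *m G = G *m companion_mx a -> krylov X = G.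
Proof.
move=> G0 XG; apply/matrixP => i j; rewrite mxE.
case: j => j /=; elim: j i => [|j IHj] i lt_j.
  rewrite expr0 mxE (_ : Ordinal _ = 0) ?G0 //; exact/val_inj.
have lt_jm : (j < m.+1)%N := ltnW lt_j.
have /matrixP/(_ i (Ordinal lt_jm)) := XG.
rewrite mul_companion_mx /= ifN; last by rewrite neq_ltn -ltnS lt_j.
rewrite (_ : inord j.+1 = Ordinal lt_j); last by apply/val_inj; rewrite /= inordK.
move=> <-; rewrite exprS !mxE; apply: eq_bigr => k _.
by rewrite (IHj _ lt_jm).
Qed.

(** The coordinates u (first block) and s (second block). Column 0 of the Krylov matrix is always
    e_0 and the constant coefficient is fixed by the determinant, so both are left out; n(n-1) +
    (n-1) is the dimension of SL_n. *)
Definition kry_coords X (k : 'I_(m.+1 * m + m)) : R :=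
  match split k with
  | inl ij => mxvec (\matrix_(i < m.+1, j < m) krylov X i (lift 0 j)) 0 ij
  | inr k' => (char_poly X)`_k'.+1
  end.

Definition kry_mx (v : 'I_(m.+1 * m + m) -> R) : 'M[R]_m.+1 :=
  \matrix_(i, j) if unlift 0 j is Some j' then v (lshift m (mxvec_index i j'))
                 else (i == 0)%:R.

(* The constant coefficient is that of a matrix of determinant 1. *)
Definition kry_cp (v : 'I_(m.+1 * m + m) -> R) (k : nat) : R :=
  if k is k'.+1 then
    if (insub k' : option 'I_m) is Some j then v (rshift (m.+1 * m) j) else 0
  else (- 1) ^+ m.+1.

Lemma kry_mx0 v i : kry_mx v i 0 = (i == 0)%:R.
Proof. by rewrite mxE unlift_none. Qed.

Lemma kry_mx_coords X : kry_mx (kry_coords X) = krylov X.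
Proof.
apply/matrixP => i j; rewrite mxE; case: unliftP => [j' ->|->].
  by rewrite /kry_coords (unsplitK (inl _)) mxvecE mxE.
by rewrite mxE expr0 mxE.
Qed.

Lemma kry_cp_coords X (k : 'I_m.+1) :
  \det X = 1 -> kry_cp (kry_coords X) k = (char_poly X)`_k.
Proof.
move=> dX; case: k => -[|k] /= lt_k; first by rewrite char_poly_det dX mulr1.
by rewrite insubT /kry_coords (unsplitK (inr _)).
Qed.

Lemma kry_coordsP X : \det X = 1 ->
  X *m kry_mx (kry_coords X) =
    kry_mx (kry_coords X) *m companion_mx (kry_cp (kry_coords X)).
Proof.
move=> dX; rewrite kry_mx_coords krylov_companion; congr (_ *m _).
by apply/matrixP => i j; rewrite !mxE kry_cp_coords.
Qed.

End Krylov.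

Arguments companion_mx {R m} a.

(** The Krylov matrix of X is [kry_mx v] by [krylov_unique]. Cancelling it against
    [krylov_companion] identifies the two companion matrices, whose last columns give the
    coefficients; the constant one gives the determinant. *)
Lemma kry_coords_unique (R : comUnitRingType) m (X : 'M[R]_m.+1) v :
  kry_mx v \in unitmx ->
  X *m kry_mx v = kry_mx v *m companion_mx (kry_cp v) ->
  \det X = 1 /\ kry_coords X =1 v.
Proof.
move=> uG XG; have eG := krylov_unique (kry_mx0 v) XG.
have acp (k : 'I_m.+1) : (char_poly X)`_k = kry_cp v k.
  have := XG; rewrite -{1 2}eG krylov_companion eG => /(can_inj (mulKmx uG)).
  by move/matrixP/(_ k ord_max); rewrite !mxE eqxx => /oppr_inj.
split.
  have := acp 0; rewrite char_poly_det /= -{2}[(- 1) ^+ _]mulr1.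
  by move/(can_inj (signrMK _)).
move=> k; rewrite /kry_coords -[k in RHS]splitK; case: (split k) => [ij|k'] /=.
  case/mxvec_indexP: ij => i j; rewrite mxvecE mxE eG mxE.
  by case: unliftP => [j' /lift_inj->|/eqP]; rewrite // eq_sym (negPf (neq_lift _ _)).
rewrite (acp (lift 0 k')) /= insubT ?ltn_ord // => lt_k.
by congr v; congr rshift; apply: val_inj.
Qed.

Section KrylovMap.
Variables (R S : comNzRingType) (m : nat) (f : {rmorphism R -> S}).

Lemma map_kry_coords (X : 'M[R]_m.+1) k :
  f (kry_coords X k) = kry_coords (map_mx f X) k.
Proof.
rewrite /kry_coords; case: split => [ij|k'].
  case/mxvec_indexP: ij => i j; rewrite !mxvecE !mxE.
  by rewrite -rmorphXn /= mxE.
by rewrite -map_char_poly coef_map.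
Qed.

Lemma map_kry_mx (v : 'I_(m.+1 * m + m) -> R) :
  map_mx f (kry_mx v) = kry_mx (f \o v).
Proof.
by apply/matrixP => i j; rewrite !mxE; case: unlift => //=; rewrite rmorph_nat.
Qed.

Lemma map_kry_cp (v : 'I_(m.+1 * m + m) -> R) k : f (kry_cp v k) = kry_cp (f \o v) k.
Proof.
case: k => [|k] /=; first by rewrite rmorphXn rmorphN1.
by case: insubP => [k' _ _|_] //=; rewrite rmorph0.
Qed.

Lemma map_companion_mx (v : 'I_(m.+1 * m + m) -> R) :
  map_mx f (companion_mx (kry_cp v)) = companion_mx (kry_cp (f \o v)) :> 'M_m.+1.
Proof.
apply/matrixP => i j; rewrite !mxE; case: ifP => _; last by rewrite rmorph_nat.
by rewrite rmorphN map_kry_cp.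
Qed.

End KrylovMap.

(** * Derivations and the pairing with sl_n *)

Section Derivation.
Variables (R : idomainType) (D : {additive R -> R}).
Hypothesis DM : forall a b, D (a * b) = D a * b + a * D b.

Lemma der1 : D 1 = 0.
Proof.
by have /eqP := DM 1 1; rewrite !mulr1 mul1r -subr_eq0 opprD addNKr oppr_eq0 => /eqP.
Qed.

Lemma map_derM k l q (A : 'M[R]_(k, l)) (B : 'M_(l, q)) :
  map_mx D (A *m B) = map_mx D A *m B + A *m map_mx D B.
Proof.
apply/matrixP => i j; rewrite !mxE raddf_sum -big_split.
by apply: eq_bigr => h _; rewrite DM !mxE.
Qed.

Variables (m : nat) (X x : 'M[R]_m.+1).

(** The Krylov matrix of X with starting vector y e_0 in place of e_0. *)
Definition krylov_at (y : 'M[R]_m.+1) : 'M[R]_m.+1 :=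
  \matrix_(i, j) (X ^+ j *m y) i 0.

Lemma mul_krylov_at y :
  X *m krylov_at y = krylov_at y *m companion_mx (fun k => (char_poly X)`_k).
Proof.
apply/matrixP => i j; rewrite mul_companion_mx.
have -> : (X *m krylov_at y) i j = (X ^+ j.+1 *m y) i 0.
  by rewrite exprS -mulmxA !mxE; apply: eq_bigr => k _; rewrite !mxE.
case: ifPn => [/eqP->|jm].
  rewrite Cayley_Hamilton_expr mulNmx mulmx_suml mxE summxE; congr (- _).
  by apply: eq_bigr => k _; rewrite -scalemxAl !mxE.
by rewrite [RHS]mxE inordK // ltnS ltn_neqAle jm -ltnS ltn_ord.
Qed.

Hypothesis DX : map_mx D X = X *m x - x *m X.

Lemma map_der_expmx k : map_mx D (X ^+ k) = X ^+ k *m x - x *m X ^+ k.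
Proof.
elim: k => [|k IHk].
  rewrite !expr0 mul1mx mulmx1 subrr; apply/matrixP => i j.
  by rewrite !mxE; case: (i == j); rewrite ?der1 ?raddf0.
rewrite exprS [X * _]/(X *m _) map_derM DX IHk mulmxBl mulmxBr !mulmxA.
by rewrite addrC subrKA.
Qed.

Lemma map_der_krylov : map_mx D (krylov X) = krylov_at x - x *m krylov X.
Proof.
apply/matrixP => i j; have /matrixP/(_ i 0) := map_der_expmx j.
rewrite !mxE => ->; congr (_ - _).
by apply: eq_bigr => k _; rewrite !mxE.
Qed.

(** Differentiating X G = G C, with G the Krylov matrix, all terms cancel except G D(C). As det G is
    nonzero in a domain, D(C) = 0, and the last column of C holds the coefficients of index at most
    m. *)
Lemma der_char_poly k : \det (krylov X) != 0 -> D (char_poly X)`_k = 0.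
Proof.
move=> nG; set C := companion_mx (fun k => (char_poly X)`_k) : 'M_m.+1.
have GDC0 : krylov X *m map_mx D C = 0.
  have := congr1 (map_mx D) (krylov_companion X).
  rewrite !map_derM DX map_der_krylov -/C mulmxBl mulmxBl mulmxBr mul_krylov_at -/C.
  rewrite -!mulmxA -krylov_companion => E.
  apply: (addrI (krylov_at x *m C - x *m (X *m krylov X))); rewrite addr0 -E.
  by rewrite addrC subrKA.
have {GDC0} DC0 : map_mx D C = 0.
  have := congr1 (mulmx (\adj (krylov X))) GDC0.
  rewrite mulmxA mul_adj_mx mul_scalar_mx mulmx0 => /eqP.
  by rewrite scalemx_eq0 (negPf nG) => /eqP.
have [lt_km|] := ltnP k m.+1.
  have /matrixP/(_ (Ordinal lt_km) ord_max) := DC0.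
  by rewrite !mxE eqxx raddfN /= => /eqP; rewrite oppr_eq0 => /eqP.
rewrite leq_eqVlt => /predU1P[<-|lt_mk]; last first.
  by rewrite nth_default ?raddf0 // size_char_poly.
have := monicP (char_poly_monic X); rewrite lead_coefE size_char_poly /= => ->.
exact: der1.
Qed.

End Derivation.

Lemma mxtrace_mul_delta (R : comNzRingType) n (B : 'M[R]_n) i j :
  \tr (B *m delta_mx i j) = B j i.
Proof.
rewrite -(mul_delta_mx (0 : 'I_1)) mulmxA -colE mxtrace_mulC -rowE.
by rewrite trace_mx11 [LHS]mxE [LHS]mxE.
Qed.

(** * Nondegeneracy of the pairing with the variation of the Krylov matrix *)

Section TracePairing.
Variables (R : idomainType) (m : nat) (X W : 'M[R]_m.+1).
Let G := krylov X.
Let Phi y := \sum_i \sum_j W i j * (krylov_at X y - y *m G) i j.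

Hypotheses (nG : \det G != 0) (nX : \tr X != 0) (W0 : forall i, W i 0 = 0).
Hypothesis Phi_offdiag : forall i j, i != j -> Phi (delta_mx i j) = 0.
Hypothesis Phi_diag : forall i, Phi (delta_mx i i - delta_mx 0 0) = 0.

(** The matrix of the linear form [Phi] for the trace pairing. The first summand is confined to row
    0 because [krylov_at X y] depends only on column 0 of y. *)
Let B : 'M[R]_m.+1 :=
  \matrix_(a, b) ((a == 0)%:R * \sum_(j < m.+1) (W^T *m X ^+ j) j b) - G *m W^T.

Let PhiE y : Phi y = \tr (B *m y).
Proof.
rewrite /B mulmxBl raddfB /= -mulmxA [X in _ - X]mxtrace_mulC /Phi.
under eq_bigr => i _ do under eq_bigr => j _ do rewrite [X in _ * X]mxE mulrDr.
under eq_bigr => i _ do rewrite big_split /=.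
rewrite big_split /=; congr (_ + _).
  rewrite [RHS]/mxtrace [RHS](bigD1 0) //= [X in _ + X]big1 ?addr0 => [|a na]; last first.
    by rewrite mxE big1 // => b _; rewrite mxE (negPf na) !mul0r.
  rewrite exchange_big /=.
  transitivity (\sum_(j < m.+1) (W^T *m X ^+ j *m y) j 0).
    apply: eq_bigr => j _; rewrite -mulmxA mxE; apply: eq_bigr => i _.
    by rewrite !mxE.
  under eq_bigr => j _ do rewrite mxE.
  rewrite exchange_big mxE; apply: eq_bigr => b _ /=.
  by rewrite mxE mul1r mulr_suml.
rewrite exchange_big -sumrN; apply: eq_bigr => j _.
rewrite -mulmxA [in RHS]mxE -sumrN; apply: eq_bigr => i _.
by rewrite !mxE mulrN.
Qed.

(* The pairing vanishes on sl_n, so it is a multiple of the trace; evaluating it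
   at [X], where it also vanishes, kills the multiple as \tr X != 0. *)
Lemma krylov_pairing_nondeg : W = 0.
Proof.
have Bscal : B = (B 0 0)%:M.
  apply/matrixP => i j; rewrite [RHS]mxE; case: eqVneq => [<-|nij]; last first.
    by rewrite -mxtrace_mul_delta -PhiE Phi_offdiag // eq_sym.
  have := Phi_diag i; rewrite PhiE mulmxBr raddfB /= !mxtrace_mul_delta => /eqP.
  by rewrite subr_eq0 => /eqP ->.
(* Both terms of the variation have columns X^(j+1) e_0 at y = X, reflecting that X commutes with
   itself. *)
have PhiX : Phi X = 0.
  rewrite /Phi (_ : krylov_at X X - X *m G = 0).
    by rewrite big1 // => i _; rewrite big1 // => j _; rewrite mxE mulr0.
  apply/matrixP => i j; rewrite mxE [krylov_at _ _ _ _]mxE [(- _ : 'M_m.+1) _ _]mxE.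
  by rewrite mul_krylov exprSr subrr mxE.
have B00 : B 0 0 = 0.
  have /eqP : \tr ((B 0 0)%:M *m X) = 0 by rewrite -Bscal -PhiE.
  by rewrite mul_scalar_mx linearZ /= mulf_eq0 (negPf nX) orbF => /eqP.
have GW i j : i != 0 -> (G *m W^T) i j = 0.
  move=> ni; have /matrixP/(_ i j) := Bscal.
  by rewrite B00 !mxE mul0rn (negPf ni) mul0r add0r => /eqP; rewrite oppr_eq0 => /eqP.
apply/matrixP => i j; rewrite [RHS]mxE; have [->|nj] := eqVneq j 0; first exact: W0.
(* Column 0 of G is e_0, hence column 0 of adj G is det G e_0. In adj G (G W^T) = det G W^T, row j
   then sees only the rows of G W^T other than row 0, which vanish by [GW]. *)
have adj0 : (\adj G) j 0 = 0.
  have G0 k : G k 0 = (k == 0)%:R by rewrite mxE expr0 mxE.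
  have /matrixP/(_ j 0) := mul_adj_mx G.
  rewrite [LHS]mxE [RHS]mxE (negPf nj) (bigD1 0) //= big1 => [|k nk].
    by rewrite G0 mulr1 addr0.
  by rewrite G0 (negPf nk) mulr0.
apply/eqP; suff /eqP : \det G * W i j = 0 by rewrite mulf_eq0 (negPf nG).
have /matrixP/(_ j i) := congr1 (mulmx^~ W^T) (mul_adj_mx G).
rewrite -mulmxA mul_scalar_mx [in RHS]mxE [W^T _ _]mxE => <-.
rewrite mxE big1 // => k _; have [->|nk] := eqVneq k 0; first by rewrite adj0 mul0r.
by rewrite GW ?mulr0.
Qed.

End TracePairing.

(** * Polynomials in p-th powers *)

Section Mmap.

Lemma rmorph_mmap r (R S T : comNzRingType) (f : {rmorphism R -> S})
    (g : {rmorphism S -> T}) (h : 'I_r -> S) (P : {mpoly R[r]}) :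
  g (mmap f h P) = mmap (g \o f) (g \o h) P.
Proof.
rewrite /mmap rmorph_sum; apply: eq_bigr => m _; rewrite rmorphM /mmap1 rmorph_prod.
by congr (_ * _); apply: eq_bigr => i _; rewrite rmorphXn.
Qed.

Lemma eq_mmap r (R S : nzRingType) (f f' : R -> S) (h h' : 'I_r -> S) (P : {mpoly R[r]}) :
  f =1 f' -> h =1 h' -> mmap f h P = mmap f' h' P.
Proof.
move=> ff' hh'; apply: eq_bigr => m _; rewrite ff'; congr (_ * _).
by apply: eq_bigr => i _; rewrite hh'.
Qed.

Lemma mmap_id r (R : comNzRingType) (P : {mpoly R[r]}) :
  mmap (@mpolyC r R) (fun k => 'X_k) P = P.
Proof.
rewrite [RHS]mpolyE; apply: eq_bigr => m _; rewrite mul_mpolyC; congr (_ *: _).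
exact: mmap1_id.
Qed.

Lemma mpoly_ring_ind r (R : comNzRingType) (Q : {mpoly R[r]} -> Prop) :
  (forall c, Q c%:MP) -> (forall i, Q 'X_i) ->
  (forall A B, Q A -> Q B -> Q (A + B)) -> (forall A B, Q A -> Q B -> Q (A * B)) ->
  forall P, Q P.
Proof.
move=> QC QX QD QM; elim/mpolyind => [|c m P _ _ IH]; first by rewrite -mpolyC0.
apply: QD => //; rewrite -mul_mpolyC; apply: (QM) => //.
rewrite mpolyXE_id; elim/big_ind: _ => [|A B|i _]; first by rewrite -mpolyC1.
  exact: QM.
elim: (m i) => [|e IHe]; first by rewrite expr0 -mpolyC1.
by rewrite exprS; apply: QM.
Qed.

Lemma der_mmap r (R S : comNzRingType) (f : {rmorphism R -> S}) (h : 'I_r -> S)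
    (D : {additive S -> S}) (P : {mpoly R[r]}) :
    (forall a b, D (a * b) = D a * b + a * D b) -> (forall c, D (f c) = 0) ->
  D (mmap f h P) = \sum_k mmap f h P^`M(k) * D (h k).
Proof.
move=> DM Df; elim/mpoly_ring_ind: P => [c|i|A B IHA IHB|A B IHA IHB].
- by rewrite mmapC Df big1 // => k _; rewrite mderivC mmap0 mul0r.
- rewrite mmapX mmap1U (bigD1 i) //= big1 ?addr0 => [|k nk].
    rewrite mderivX mnm1E eqxx scale1r -[X in (X - _)%MM]add0m addmK.
    by rewrite mpolyX0 rmorph1 mul1r.
  by rewrite mderivX mnm1E eq_sym (negPf nk) scale0r mmap0 mul0r.
- rewrite rmorphD raddfD /= IHA IHB -big_split; apply: eq_bigr => k _ /=.
  by rewrite mderivD rmorphD mulrDl.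
rewrite rmorphM DM /= IHA IHB mulr_suml mulr_sumr -big_split.
by apply: eq_bigr => k _ /=; rewrite mderivM rmorphD !rmorphM /=; ring.
Qed.

End Mmap.

Section Rescale.
Variables (r : nat) (R : comNzRingType) (e : 'I_r -> nat).
Implicit Types P : {mpoly R[r]}.

Definition expand_mpoly P : {mpoly R[r]} := mmap (@mpolyC r R) (fun k => 'X_k ^+ e k) P.

Definition expand_mnm (m : 'X_{1..r}) : 'X_{1..r} := [multinom (e k * m k)%N | k < r].

Lemma expand_mpolyE P :
  expand_mpoly P = \sum_(m <- msupp P) P@_m *: 'X_[expand_mnm m].
Proof.
apply: eq_bigr => m _; rewrite mul_mpolyC; congr (_ *: _).
rewrite [RHS]mpolyXE_id; apply: eq_bigr => k _.
by rewrite -exprM mnmE.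
Qed.

Lemma mmap_expand (S : comNzRingType) (f : {rmorphism R -> S}) (h : 'I_r -> S) P :
  mmap f h (expand_mpoly P) = mmap f (fun k => h k ^+ e k) P.
Proof.
rewrite /expand_mpoly (rmorph_mmap _ (mmap f h)); apply: eq_mmap => [c|k] /=.
  by rewrite mmapC.
by rewrite rmorphXn /= mmapX mmap1U.
Qed.

(** Positive exponents make [expand_mnm] injective, so distinct monomials stay distinct and no
    coefficients merge. *)
Lemma expand_mpoly_eq0 P : (forall k, 0 < e k)%N -> expand_mpoly P = 0 -> P = 0.
Proof.
move=> e_gt0 P0; apply/mpolyP => m; rewrite mcoeff0.
have : (expand_mpoly P)@_(expand_mnm m) = 0 by rewrite P0 mcoeff0.
have inj_e : injective expand_mnm.
  move=> m1 m2 /mnmP e12; apply/mnmP => k; have /eqP := e12 k.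
  by rewrite !mnmE eqn_pmul2l // => /eqP.
rewrite expand_mpolyE raddf_sum /=.
under eq_bigr do rewrite mcoeffZ mcoeffX (inj_eq inj_e).
have [mP|mP] := boolP (m \in msupp P); last by rewrite (memN_msupp_eq0 mP).
rewrite (bigD1_seq m) ?msupp_uniq //= eqxx mulr1 big1 ?addr0 // => m' /negPf->.
by rewrite mulr0.
Qed.

End Rescale.

(** The derivative in X_k has coefficient m_k P_m at m - U_k; its vanishing forces p to divide m_k
    for every monomial m of P, and Q is obtained by dividing these exponents by p. *)
Lemma expand_mpoly_pchar r (K : fieldType) p (U : pred 'I_r) (P : {mpoly K[r]}) :
    p \in [pchar K] -> (forall k, U k -> P^`M(k) = 0) ->
  exists Q, P = expand_mpoly (fun k => if U k then p else 1%N) Q.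
Proof.
move=> pK P0; pose e k := if U k then p else 1%N; rewrite -/e.
have p_gt0 : (0 < p)%N := prime_gt0 (pcharf_prime pK).
have dvd_e m k : m \in msupp P -> (e k %| m k)%N.
  rewrite /e; case: ifP => // Uk mP; rewrite (dvdn_pcharf pK).
  case mk: (m k) => [|d] //.
  have Um : (m - U_(k) + U_(k))%MM = m.
    by apply/submK/mnm_lepP => l; rewrite mnm1E; case: eqVneq => // <-; rewrite mk.
  have := mcoeff_mderiv k P (m - U_(k))%MM.
  rewrite P0 // mcoeff0 Um mnmBE mk mnm1E eqxx subn1 /= => /esym/eqP.
  rewrite -[P@_m *+ _]mulr_natr mulf_eq0; move: mP; rewrite mcoeff_msupp.
  by move/negPf ->.
exists (\sum_(m <- msupp P) P@_m *: 'X_[[multinom (m k %/ e k)%N | k < r]]).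
rewrite {1}[P]mpolyE /expand_mpoly raddf_sum /= big_seq [RHS]big_seq.
apply: eq_bigr => m mP; rewrite -[in RHS]mul_mpolyC rmorphM /= mmapC mul_mpolyC.
congr (_ *: _).
rewrite mmapX mpolyXE_id; apply: eq_bigr => k _.
by rewrite -exprM mnmE mulnC divnK ?dvd_e.
Qed.

(** * Coordinates on SL_n *)

HB.instance Definition _ (K : fieldType) n (x : 'M[K]_n) :=
  GRing.isZmodMorphism.Build (coord_sl K n) (coord_sl K n) (conj_act x) (conj_actB x).

Section SLCoordinates.
Variables (K : fieldType) (m : nat).
Let A := coord_sl K m.+1.
Let r := (m.+1 * m + m)%N.
Let cst : {rmorphism K -> A} := @restr K m.+1 \o @mpolyC (m.+1 * m.+1) K.

Definition sl_genmx : 'M[A]_m.+1 := map_mx (@restr K m.+1) (Defs.genmx K m.+1).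

(** The comparison map to K[SL_n]: injective by [sl_eval_inj], and surjective once det G is inverted
    by [sl_eval_localized]. *)
Definition sl_eval : {mpoly K[r]} -> A := mmap cst (kry_coords sl_genmx).

HB.instance Definition _ := GRing.RMorphism.on sl_eval.

Lemma det_sl_genmx : \det sl_genmx = 1.
Proof.
rewrite /sl_genmx det_map_mx; apply/eqP; rewrite -subr_eq0 -(rmorph1 (@restr K m.+1)).
by rewrite -rmorphB; apply/eqP/restr_eq0; exists 1; rewrite mul1r.
Qed.

Let G : 'M[{mpoly K[r]}]_m.+1 := kry_mx (fun k => 'X_k).

Lemma det_kry_mx_neq0 : \det G != 0.
Proof.
(* The point at which G specializes to the identity matrix. *)
pose v (k : 'I_r) : K := match split k with
  inl ij => mxvec (\matrix_(i < m.+1, j < m) (i == lift 0 j)%:R) 0 ij | _ => 0 end.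
have /(congr1 determinant) : map_mx (meval v) G = 1%:M.
  rewrite map_kry_mx; apply/matrixP => i j; rewrite !mxE.
  case: unliftP => [j' ->|->] //=.
  by rewrite mevalXU /v (unsplitK (inl _)) mxvecE mxE.
rewrite det_map_mx det1; apply: contra_eq_neq => ->.
by rewrite rmorph0 eq_sym oner_eq0.
Qed.

(* A polynomial vanishing on SL_n vanishes at G C G^-1, the generic matrix of
   determinant 1 written in the coordinates [kry_coords]. *)
Lemma sl_eval_inj : injective sl_eval.
Proof.
apply: raddf_inj => P; rewrite /sl_eval => P0.
pose F := {fraction {mpoly K[r]}}.
pose tof : {rmorphism _ -> F} := @FracField.tofrac {mpoly K[r]}.
pose v : 'I_r -> F := fun k => tof 'X_k.
have uG : kry_mx v \in unitmx.
  rewrite -[v]/(tof \o _) -map_kry_mx unitmxE det_map_mx unitfE tofrac_eq0.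
  exact: det_kry_mx_neq0.
pose M := kry_mx v *m companion_mx (kry_cp v) *m invmx (kry_mx v).
have [dM cM] : \det M = 1 /\ kry_coords M =1 v.
  by apply: kry_coords_unique => //; rewrite mulmxKV.
pose ev : {rmorphism matpoly K m.+1 -> F} :=
  mmap (tof \o @mpolyC r K) (fun k => mxvec M 0 k).
have evC c : ev c%:MP = tof c%:MP by rewrite /= mmapC.
have evX : map_mx ev (Defs.genmx K m.+1) = M.
  by apply/matrixP => i j; rewrite 2![in LHS]mxE /= mmapX mmap1U mxvecE.
have evdet : ev (\det (Defs.genmx K m.+1)) = 1 by rewrite -det_map_mx evX.
have : restr (mmap (@mpolyC (m.+1 * m.+1) K) (kry_coords (Defs.genmx K m.+1)) P) = 0.
  rewrite rmorph_mmap -[RHS]P0; apply: eq_mmap => // k.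
  exact: map_kry_coords.
move/restr_eq0 => [Q /(congr1 ev)].
rewrite [RHS]rmorphM rmorphB rmorph1 evdet subrr mulr0 rmorph_mmap.
(* By [cM] the coordinates of M are the variables themselves, so evaluating at M gives back P. *)
rewrite (eq_mmap (f' := tof \o @mpolyC r K) (h' := tof \o (fun k => 'X_k))) //.
  by rewrite -rmorph_mmap mmap_id => /eqP; rewrite tofrac_eq0 => /eqP.
by move=> k; rewrite /comp map_kry_coords evX cM.
Qed.

Lemma map_sl_eval_kry_mx : map_mx sl_eval G = krylov sl_genmx.
Proof.
rewrite map_kry_mx -kry_mx_coords; congr kry_mx; apply/funext => k /=.
by rewrite /sl_eval mmapX mmap1U.
Qed.

Lemma sl_eval_det : sl_eval (\det G) = \det (krylov sl_genmx).
Proof. by rewrite -map_sl_eval_kry_mx det_map_mx. Qed.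

Lemma det_krylov_sl_neq0 : \det (krylov sl_genmx) != 0.
Proof. by rewrite -sl_eval_det raddf_eq0 ?det_kry_mx_neq0 //; exact: sl_eval_inj. Qed.

(** From X G = G C one gets det G X = G C adj G, so one factor det G clears the denominators of the
    entries of X; sums and products follow. *)
Lemma sl_eval_localized (f : A) :
  exists N P, f * sl_eval (\det G ^+ N) = sl_eval P.
Proof.
rewrite -[f]lift_slK; move: (lift_sl f) => {f} P0.
elim/mpoly_ring_ind: P0 => [c|k|P Q [N [P' hP]] [M [Q' hQ]]|P Q [N [P' hP]] [M [Q' hQ]]].
- by exists 0%N, c%:MP; rewrite expr0 rmorph1 mulr1 /sl_eval mmapC.
- case/mxvec_indexP: k => i j.
  exists 1%N, ((G *m companion_mx (kry_cp (fun k => 'X_k)) *m \adj G) i j).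
  transitivity ((sl_genmx *m krylov sl_genmx *m \adj (krylov sl_genmx)) i j).
    rewrite -mulmxA mul_mx_adj mul_mx_scalar mxE mulrC expr1 sl_eval_det; congr (_ * _).
    by rewrite !mxE.
  rewrite -kry_mx_coords kry_coordsP ?det_sl_genmx // kry_mx_coords.
  rewrite -map_sl_eval_kry_mx -map_mx_adj.
  rewrite (_ : companion_mx _ = map_mx sl_eval (companion_mx (kry_cp (fun k => 'X_k)))).
    by rewrite -!map_mxM mxE.
  rewrite map_companion_mx; congr (companion_mx (kry_cp _)); apply/funext => k /=.
  by rewrite /sl_eval mmapX mmap1U.
- exists (N + M)%N, (P' * \det G ^+ M + Q' * \det G ^+ N).
  rewrite exprD !rmorphD !rmorphM /= -hP -hQ !rmorphXn /=; ring.
exists (N + M)%N, (P' * Q').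
rewrite exprD !rmorphM /= -hP -hQ !rmorphXn /=; ring.
Qed.

Lemma kry_cp_neq0 k : (k <= m)%N -> kry_cp (fun k => 'X_k : {mpoly K[r]}) k != 0.
Proof.
case: k => [|k] le_k /=; first by rewrite signr_eq0.
rewrite insubT; apply/eqP => /(congr1 (mcoeff U_(rshift (m.+1 * m) (Ordinal le_k)))).
by rewrite mcoeffX eqxx mcoeff0 => /eqP; rewrite oner_eq0.
Qed.

(** Up to sign the trace is the coefficient of index m, which is one of the variables s if m > 0 and
    the constant -1 if m = 0. This covers the case where p divides n. *)
Lemma sl_genmx_trace_neq0 : \tr sl_genmx != 0.
Proof.
rewrite -oppr_eq0 -char_poly_trace // -(kry_cp_coords ord_max det_sl_genmx).
have -> : kry_coords sl_genmx = sl_eval \o (fun k => 'X_k).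
  by apply/funext => k; rewrite /= /sl_eval mmapX mmap1U.
rewrite -map_kry_cp raddf_eq0; last exact: sl_eval_inj.
exact: kry_cp_neq0.
Qed.

(** Supplies the hypothesis [DX] of the derivation lemmas for the derivation [conj_act x]. *)
Lemma conj_act_sl_genmx (x : 'M[K]_m.+1) : map_mx (conj_act x) sl_genmx =
  sl_genmx *m map_mx cst x - map_mx cst x *m sl_genmx.
Proof.
apply/matrixP => i j; rewrite [LHS]mxE [sl_genmx _ _]mxE conj_actE conj_polyE /vfield.
rewrite (bigD1 i) //= (bigD1 j) //= mderiv_genmx !eqxx mulr1.
rewrite big1 => [|j' nj]; last by rewrite mderiv_genmx eq_sym (negPf nj) andbF mulr0.
rewrite big1 => [|i' ni]; last first.
  by rewrite big1 // => j' _; rewrite mderiv_genmx [i == i']eq_sym (negPf ni) mulr0.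
have -> : map_mx cst x = map_mx (@restr K m.+1) (cstmx x).
  by apply/matrixP => i' j'; rewrite !mxE.
by rewrite !addr0 -!map_mxM -map_mxB [RHS]mxE.
Qed.

Lemma conj_act_kry_cp (x : 'M[K]_m.+1) k :
  conj_act x (kry_coords sl_genmx (rshift (m.+1 * m) k)) = 0.
Proof.
rewrite /kry_coords (unsplitK (inr _)).
apply: (der_char_poly (conj_actM x) (conj_act_sl_genmx x)).
exact: det_krylov_sl_neq0.
Qed.

(** By the chain rule x acts on [sl_eval P] as the pairing of the u-derivatives of P with the
    variation of G along x, the s-terms being zero by invariance. [krylov_pairing_nondeg] then kills
    these derivatives. *)
Lemma sl_invariant_mderiv (P : {mpoly K[r]}) :
  sl_eval P \in @sl_invariant K m.+1 -> forall k, P^`M(lshift m k) = 0.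
Proof.
move=> /asboolP invP.
(* Column 0 is set to 0 to match the constant column e_0 of G, which carries no coordinate. *)
pose W : 'M[A]_m.+1 := \matrix_(i, j) if unlift 0 j is Some j'
  then sl_eval P^`M(lshift m (mxvec_index i j')) else 0.
pose Phi y := \sum_i \sum_j W i j * (krylov_at sl_genmx y - y *m krylov sl_genmx) i j.
have Phi0 (x : 'M[K]_m.+1) : \tr x = 0 -> Phi (map_mx cst x) = 0.
  move=> trx; rewrite -[RHS](invP x); last by rewrite unfold_in trx.
  rewrite /sl_eval der_mmap; [|exact: conj_actM|exact: conj_actC].
  rewrite big_split_ord /= [X in _ + X]big1 ?addr0 => [|k _]; last first.
    by rewrite conj_act_kry_cp mulr0.
  rewrite (reindex _ (curry_mxvec_bij _ _)) /=.
  transitivity (\sum_i \sum_j sl_eval P^`M(lshift m (mxvec_index i j)) *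
    conj_act x (kry_coords sl_genmx (lshift m (mxvec_index i j)))); last first.
    by rewrite pair_bigA; apply: eq_bigr => -[i j] _.
  apply: eq_bigr => i _; rewrite big_ord_recl /= mxE unlift_none mul0r add0r.
  apply: eq_bigr => j _; rewrite mxE liftK; congr (_ * _).
  rewrite -(map_der_krylov (conj_actM x) (conj_act_sl_genmx x)) mxE.
  by rewrite /kry_coords (unsplitK (inl _)) mxvecE mxE.
have tr_delta i j : \tr (delta_mx i j : 'M[K]_m.+1) = (i == j)%:R.
  by rewrite -[delta_mx i j]mul1mx mxtrace_mul_delta mxE eq_sym.
(* [Phi0] speaks only of matrices over K, but the basis of sl_n tested here determines the A-linear
   form on all traceless matrices over A. *)
have W0 : W = 0.
  apply: (@krylov_pairing_nondeg _ _ sl_genmx).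
  - exact: det_krylov_sl_neq0.
  - exact: sl_genmx_trace_neq0.
  - by move=> i; rewrite mxE unlift_none.
  - move=> i j nij; rewrite -(map_delta_mx cst); apply: Phi0.
    by rewrite tr_delta (negPf nij).
  move=> i; rewrite -!(map_delta_mx cst) -map_mxB; apply: Phi0.
  by rewrite raddfB /= !tr_delta !eqxx subrr.
move=> k; case/mxvec_indexP: k => i j; apply: sl_eval_inj.
by have /matrixP/(_ i (lift 0 j)) := W0; rewrite !mxE liftK rmorph0.
Qed.

End SLCoordinates.

(** * The field of fractions of the invariants *)

Lemma fracP (R : idomainType) (z : {fraction R}) :
  exists a b, b != 0 /\ z = FracField.tofrac a / FracField.tofrac b.
Proof.
elim/quotW: z => x; exists \n_x, \d_x; split; first exact: denom_ratioP.
have d0 : FracField.tofrac \d_x != 0 by rewrite tofrac_eq0 denom_ratioP.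
apply: (canRL (mulfK d0)); unlock FracField.tofrac; rewrite -[LHS]FracField.pi_mul.
apply/eqP; rewrite FracField.equivf_def /FracField.mulf /=.
by rewrite !numden_Ratio ?(mulr1, oner_neq0, denom_ratioP) // mulrC.
Qed.

Lemma der_expn (R : comNzRingType) (D : {additive R -> R}) (a : R) k :
  (forall a b, D (a * b) = D a * b + a * D b) -> D (a ^+ k.+1) = a ^+ k * D a *+ k.+1.
Proof.
move=> DM; elim: k => [|k IHk]; first by rewrite expr1 expr0 mul1r.
by rewrite exprS DM IHk mulrnAr mulrA -exprS mulrC -mulrS.
Qed.

Lemma der_expn_pchar (R : comNzRingType) p (D : {additive R -> R}) (a : R) :
    p \in [pchar R] -> (forall a b, D (a * b) = D a * b + a * D b) ->
  D (a ^+ p) = 0.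
Proof.
move=> pR DM; have := prime_gt0 (pcharf_prime pR); case: p pR => // k pR _.
by rewrite der_expn // -mulr_natr pcharf0 // mulr0.
Qed.

(** * The generators u^p and s *)

Section Generators.
Variables (K : fieldType) (p m : nat) (pK : p \in [pchar K]).
Let r := (m.+1 * m + m)%N.

Definition is_vector_coord (k : 'I_r) := if split k is inl _ then true else false.

Let e k := if is_vector_coord k then p else 1%N.

Fact sl_invariant_gen k : kry_coords (sl_genmx K m) k ^+ e k \in @sl_invariant K m.+1.
Proof.
apply/asboolP => x _; rewrite /e -[k]splitK; case: (split k) => k' /=.
  rewrite /is_vector_coord (unsplitK (inl _)) der_expn_pchar //; last exact: conj_actM.
  by rewrite (rmorph_pchar (@restr K m.+1 \o @mpolyC (m.+1 * m.+1) K)).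
by rewrite /is_vector_coord (unsplitK (inr _)) expr1 conj_act_kry_cp.
Qed.

Definition sl_gen k : sl_invariants K m.+1 := SLInvariant (sl_invariant_gen k).

Definition sl_gen_eval : {mpoly K[r]} -> sl_invariants K m.+1 :=
  mmap (@sl_invariants_cst K m.+1) sl_gen.

Lemma val_sl_gen_eval P : val (sl_gen_eval P) = sl_eval (expand_mpoly e P).
Proof.
rewrite rmorph_mmap /sl_eval mmap_expand.
exact: eq_mmap.
Qed.

(** Algebraic independence of u^p and s, inherited from that of u and s because raising variables to
    positive powers is injective on polynomials. *)
Lemma sl_gen_eval_inj : injective sl_gen_eval.
Proof.
apply: raddf_inj => P; rewrite -[_ P]/(sl_gen_eval P) => P0.
apply: (@expand_mpoly_eq0 _ _ e).
  by move=> k; rewrite /e; case: ifP => // _; apply: prime_gt0 (pcharf_prime pK).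
by apply: sl_eval_inj; rewrite -val_sl_gen_eval P0 !rmorph0.
Qed.

Lemma sl_eval_genP (P : {mpoly K[r]}) : (forall k, P^`M(lshift m k) = 0) ->
  exists Q, sl_eval P = val (sl_gen_eval Q).
Proof.
move=> dP; have [|Q PE] := @expand_mpoly_pchar r K p is_vector_coord P pK.
  move=> k; rewrite /is_vector_coord -{2}[k]splitK.
  by case: split => //= k' _.
by exists Q; rewrite val_sl_gen_eval PE.
Qed.

(** Write f = P / d^N = P d^(N(p-1)) / d^(Np). The new denominator is a p-th power, hence a
    polynomial in u^p and s; the new numerator is then a product of invariants, to which
    [sl_invariant_mderiv] applies. *)
Lemma sl_gen_fraction (f : sl_invariants K m.+1) :
  exists P Q, Q != 0 /\ f * sl_gen_eval Q = sl_gen_eval P.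
Proof.
have [N [P fP]] := sl_eval_localized (val f).
set d := \det _ in fP.
have [|Q QE] := @sl_eval_genP ((d ^+ N) ^+ p).
  move=> k; apply: (@der_expn_pchar _ p (mderiv (lshift m k))).
    by rewrite (rmorph_pchar (@mpolyC r K)).
  exact: mderivM.
have p_gt0 := prime_gt0 (pcharf_prime pK).
have fQ : val (f * sl_gen_eval Q) = sl_eval (P * (d ^+ N) ^+ p.-1).
  have evM B1 B2 : sl_eval (B1 * B2) = sl_eval B1 * sl_eval B2 by rewrite rmorphM.
  by rewrite [LHS]rmorphM /= -QE evM -fP -mulrA -evM -exprS prednK.
have [|P' PE] := @sl_eval_genP (P * (d ^+ N) ^+ p.-1).
  by apply: sl_invariant_mderiv; rewrite -fQ; apply: valP.
exists P', Q; split; last by apply: val_inj; rewrite fQ.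
have: sl_eval ((d ^+ N) ^+ p) != 0.
  by rewrite raddf_eq0 ?expf_neq0 ?det_kry_mx_neq0 //; apply: sl_eval_inj.
by apply: contra_neq => Q0; rewrite QE Q0 /sl_gen_eval !rmorph0.
Qed.

End Generators.

Unset Implicit Arguments.

Theorem proposition4 (K : closedFieldType) (p n : nat)
    (char_K : p \in [pchar K]) (n_gt0 : (0 < n)%N) :
  rational_extension
    (@FracField.tofrac (sl_invariants K n) \o @sl_invariants_cst K n).
Proof.
case: n n_gt0 => // m _; set emb := _ \o _.
pose t := @FracField.tofrac (sl_invariants K m.+1) \o @sl_gen K p m char_K.
have tE P : mmap emb t P = FracField.tofrac (sl_gen_eval char_K P).
  by rewrite rmorph_mmap.
have tE0 P : (mmap emb t P == 0) = (P == 0).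
  by rewrite tE tofrac_eq0 raddf_eq0 //; apply: sl_gen_eval_inj.
exists (m.+1 * m + m)%N, t; split=> [P /eqP|z]; first by rewrite tE0 => /eqP.
have [a [b [b0 ->]]] := fracP z.
have [P1 [Q1 [nQ1 aE]]] := sl_gen_fraction char_K a.
have [P2 [Q2 [nQ2 bE]]] := sl_gen_fraction char_K b.
have nP2 : P2 != 0.
  rewrite -tE0 tE -bE tofracM mulf_eq0 tofrac_eq0 (negPf b0) -tE tE0 (negPf nQ2) //.
(* The quotient of a = P1 / Q1 by b = P2 / Q2. *)
exists (P1 * Q2), (Q1 * P2); rewrite tE0 mulf_eq0 negb_or nQ1 nP2; split=> //.
apply/eqP; rewrite eqr_div ?tE0 ?tofrac_eq0 ?mulf_neq0 //.
rewrite !tE -!tofracM tofrac_eq /sl_gen_eval !rmorphM /= -!/(sl_gen_eval _ _) -aE -bE.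
by rewrite -!mulrA [sl_gen_eval _ Q2 * b]mulrC.
Qed.
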